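(* Let $(G,N)$ be an equal order pair such that $N$ is nilpotent. (a) Assume that $N$ is a $p$-group for a prime $p$. If $H$ is a nontrivial $p'$-subgroup of $G$ (i.e. a nontrivial subgroup of order not divisible by $p$), then $NH$ is a Frobenius group with kernel $N$ and with $H$ as a Frobenius complement. In particular, for every prime $q \neq p$, the Sylow $q$-subgroups of $G$ are cyclic or generalized quaternion groups. (b) Assume that $N$ is not a group of prime-power order. Then $N = \mathbf{F}(G)$, the Fitting subgroup of $G$. Moreover, if $q$ is a prime divisor of $|G/N|$ and $Q$ is a Sylow $q$-subgroup of $G$, then $NQ/(N\cap Q)$ is a Frobenius group with kernel $N/(N\cap Q)$ and with $Q/(N\cap Q)$ as a Frobenius complement. In particular, the Sylow subgroups of $G/N$ are all cyclic or generalized quaternion groups.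
   Context: All groups are finite. If $G$ is a finite group and $N$ is a proper, nontrivial, normal subgroup of $G$, the pair $(G,N)$ is called an equal order pair if, for every $x \in G \setminus N$, all elements of the coset $xN$ have the same order as $x$. *)

(* Defs.v *)
From mathcomp Require Import all_boot all_fingroup all_solvable.

Set Implicit Arguments.
Unset Strict Implicit.
Unset Printing Implicit Defensive.

Local Open Scope group_scope.

Definition equal_order_pair (gT : finGroupType) (G N : {set gT}) : Prop :=
  [/\ N <| G, N \proper G, N != 1
    & forall x, x \in G :\: N -> forall y, y \in x *: N -> #[y] = #[x]].

(* 'Q_m is the generalized quaternion group only for m = 2 ^ n >= 8. *)
Definition generalized_quaternion (gT : finGroupType) (A : {set gT}) : Prop :=
  exists2 n : nat, 2 < n & A \isog 'Q_(2 ^ n).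

Definition prime_power_order (gT : finGroupType) (A : {set gT}) : Prop :=
  exists p k : nat, prime p /\ #|A| = (p ^ k)%N.

(* The quotient A / B of the library is the image of 'N_A(B) only; under the
   hypotheses on N and Q used here, N :&: Q is normal in N * Q, so that
   N * Q / (N :&: Q), N / (N :&: Q) and Q / (N :&: Q) are the usual quotients. *)
Lemma nilpotent_Sylow_cap_normal (gT : finGroupType) (G N Q : {group gT})
    (q : nat) :
  N <| G -> nilpotent N -> q.-Sylow(G) Q -> N :&: Q <| N * Q.
Proof.
move=> nsNG nilN sylQ.
have sylNQ : q.-Sylow(N) (N :&: Q) by exact: Sylow_setI_normal nsNG sylQ.
have nNQ : Q \subset 'N(N).
  exact: subset_trans (pHall_sub sylQ) (normal_norm nsNG).
rewrite -norm_joinEr // (nilpotent_Hall_pcore nilN sylNQ).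
rewrite /normal (subset_trans (pcore_sub _ _) (joing_subl _ _)) join_subG.
by rewrite !(char_norm_trans (pcore_char _ _)) ?normG.
Qed.

(* Main.v *)
(** If [x] lies outside [N] and commutes with a nontrivial [y] in [N] of coprime
    order, then [x * y] lies in [x *: N] and has order [#[x] * #[y] <> #[x]].
    So elements outside [N] centralise nothing of coprime order in [N], which
    makes the coprime actions of both parts fixed-point-free and, since
    ['O_p(G)] centralises ['O_p^'(N)], forces ['F(G)] into [N].

    A group [H] acting fixed-point-freely on a solvable [K] has cyclic abelian
    subgroups: such a subgroup acts faithfully and irreducibly on a minimal
    invariant subgroup of [K].  If [H] is a [q]-group this gives it a unique
    subgroup of order [q], so it is cyclic or generalized quaternion. *)
From mathcomp Require Import mxrepresentation mxabelem.
Require Import Defs.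
From mathcomp Require Import all_boot all_fingroup all_solvable.

Local Open Scope group_scope.

Lemma semiregular_abelian_cyclic (gT : finGroupType) (K A : {group gT}) :
  solvable K -> K :!=: 1 -> A \subset 'N(K) -> semiregular K A ->
  abelian A -> cyclic A.
Proof.
move=> solK ntK nKA regKA cAA.
have [V minV sVK] := minnormal_exists ntK nKA.
have [nVA ntV /is_abelemP[p _ abelV]] := minnormal_solvable minV sVK solK.
have irrV := elimT (abelem_mx_irrP abelV ntV nVA) minV.
apply: mx_faithful_irr_abelian_cyclic irrV cAA.
(* The kernel of the action is the centraliser of [V] in [A], trivial because no nontrivial element
   of [A] fixes a nontrivial element of [V]. *)
rewrite /mx_faithful rker_abelem.
by rewrite (cent_semiregular (semiregular_sym regKA) sVK ntV).
Qed.

Lemma abelian_cyclic_pgroup_structure (gT : finGroupType) (q : nat)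
    (Q : {group gT}) :
  q.-group Q -> (forall A : {group gT}, A \subset Q -> abelian A -> cyclic A) ->
  cyclic Q \/ generalized_quaternion Q.
Proof.
move=> qQ cycA; have [-> | ntQ] := eqsVneq Q 1; first by left; exact: cyclic1.
have ntZ : 'Z(Q) != 1 by apply: contraNneq ntQ => /(trivg_center_pgroup qQ) ->.
have [q_pr q_dv_Z _] := pgroup_pdiv (pgroupS (center_sub Q) qQ) ntZ.
have [z Zz oz] := Cauchy q_pr q_dv_Z.
have [Qz cQz] := setIP Zz.
(* Since [z] is central, any [x] of order [q] generates with it an abelian, hence cyclic, [q]-group,
   whose only subgroup of order [q] is both [<[x]>] and [<[z]>]. *)
suffices sOz : 'Ohm_1(Q) \subset <[z]>.
  have defO : 'Ohm_1(Q) = <[z]>.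
    apply/eqP; rewrite eqEsubset sOz Ohm1Eprime cycle_subG mem_gen //.
    by rewrite inE Qz oz.
  have: #|'Ohm_1(Q)| = q by rewrite defO.
  case/(prime_Ohm1P qQ ntQ)/orP=> [|/andP[_ /eqP/quaternion_classP]]; first by left.
  by right.
rewrite Ohm1Eprime gen_subG; apply/subsetP=> x /setIdP[Qx x_pr].
have ox : #[x] = q.
  by have := mem_p_elt qQ Qx; rewrite /p_elt pnatE // => /eqP.
pose A := (<[x]> <*> <[z]>)%G.
have sAQ : A \subset Q by rewrite join_subG !cycle_subG Qx.
have cAA : abelian A.
  rewrite abelianY !cycle_abelian cycle_subG.
  by rewrite (subsetP (centS _) z cQz) ?cycle_subG.
have qA := pgroupS sAQ qQ.
have Ax : x \in A by rewrite mem_gen // inE cycle_id.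
have Az : z \in A by rewrite mem_gen // inE cycle_id orbT.
have ntA : A :!=: 1.
  by apply/trivgPn; exists z; rewrite // -order_gt1 oz prime_gt1.
have oA := Ohm1_cyclic_pgroup_prime (cycA A sAQ cAA) qA ntA.
have Ohm_mem y : y \in A -> #[y] = q -> <[y]> = 'Ohm_1(A).
  move=> Ay oy; apply/eqP; rewrite eqEcard -orderE oy oA leqnn andbT.
  by rewrite cycle_subG /= Ohm1Eprime mem_gen // inE Ay oy.
by rewrite /= (Ohm_mem z) // -(Ohm_mem x) // cycle_id.
Qed.

(** Gives the Sylow structure in both parts: the kernel is [N] in (a) and [N / (N :&: Q)] in (b). *)
Lemma Frobenius_pgroup_compl (gT : finGroupType) (q : nat) (G K Q : {group gT}) :
  [Frobenius G = K ><| Q] -> solvable K -> q.-group Q ->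
  cyclic Q \/ generalized_quaternion Q.
Proof.
move=> frobG solK qQ; have [defG ntK _ _ _] := Frobenius_context frobG.
have [_ _ _ nKQ _] := sdprod_context defG.
apply: abelian_cyclic_pgroup_structure qQ _ => A sAQ.
apply: semiregular_abelian_cyclic solK ntK (subset_trans sAQ nKQ) _.
exact: semiregularS (subxx K) sAQ (Frobenius_reg_ker frobG).
Qed.

Lemma equal_order_coprime_cent (gT : finGroupType) (G N : {group gT}) x y :
  equal_order_pair G N -> x \in G -> x \notin N -> y \in N ->
  commute x y -> coprime #[x] #[y] -> y = 1.
Proof.
case=> _ _ _ eqN Gx N'x Ny cxy coxy; apply/eqP; rewrite -order_eq1.
have /eqP : #[x * y] = #[x] by rewrite (eqN x) ?mem_lcoset ?mulKg // inE N'x.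
by rewrite orderM // -[X in _ == X]muln1 eqn_pmul2l.
Qed.

Lemma isog_cyclic_or_quaternion (aT rT : finGroupType) (A : {group aT})
    (B : {group rT}) :
  A \isog B -> cyclic A \/ generalized_quaternion A ->
  cyclic B \/ generalized_quaternion B.
Proof.
move=> isoAB [cycA | [n n_gt2 isoAQ]]; [left | right].
  by rewrite -(isog_cyclic isoAB).
by exists n => //; rewrite isog_sym in isoAB; apply: isog_trans isoAB isoAQ.
Qed.

(** Otherwise [N] would equal its [q]-core. Part (b) draws from here its nontrivial elements of [N]
    of order prime to [q]. *)
Lemma nilpotent_pcoreC_neq1 (gT : finGroupType) (N : {group gT}) (q : nat) :
  nilpotent N -> ~ prime_power_order N -> prime q -> 'O_q^'(N) != 1.
Proof.
move=> nilN notppN q_pr; apply/eqP=> trO.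
have := nilpotent_pcoreC q nilN; rewrite trO dprodg1 => defN.
have /p_natP[k oN] : q.-group N by rewrite -defN pcore_pgroup.
by apply: notppN; exists q, k.
Qed.

Lemma equal_order_pgroup_Frobenius (gT : finGroupType) (G N H : {group gT})
    (p : nat) :
  equal_order_pair G N -> p.-group N ->
  H \subset G -> H :!=: 1 -> p^'.-group H -> [Frobenius N * H = N ><| H].
Proof.
move=> eqGN pN sHG ntH p'H; have [nsNG _ ntN _] := eqGN.
have nNH := subset_trans sHG (normal_norm nsNG).
have tiNH : N :&: H = 1 by apply: coprime_TIg; apply: pnat_coprime pN p'H.
rewrite -norm_joinEr //; apply/Frobenius_semiregularP => //.
  exact: sdprodEY.
move=> x /setD1P[ntx Hx]; apply/trivgP/subsetP=> y /setIP[Ny /cent1P cxy].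
apply/set1P; apply: (equal_order_coprime_cent _ _ _ x y eqGN) => //.
- exact: (subsetP sHG).
(* A nontrivial element of [H] lies outside [N] because the orders of [N] and [H] are coprime. *)
- apply: contra ntx => Nx; have: x \in N :&: H by rewrite inE Nx.
  by rewrite tiNH inE.
rewrite coprime_sym.
exact: pnat_coprime (mem_p_elt pN Ny) (mem_p_elt p'H Hx).
Qed.

Lemma equal_order_Fitting (gT : finGroupType) (G N : {group gT}) :
  equal_order_pair G N -> nilpotent N -> ~ prime_power_order N -> N :=: 'F(G).
Proof.
move=> eqGN nilN notppN; have [nsNG _ _ _] := eqGN.
have sNF := Fitting_max nsNG nilN.
apply/eqP; rewrite eqEsubset sNF /= FittingEgen gen_subG.
apply/bigcupsP=> p piGp; apply/subsetP=> x Opx; apply: contraT => N'x.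
have p_pr : prime p by move: piGp; rewrite mem_primes => /andP[].
(* A nontrivial [y] of order prime to [p] is chosen in [N]; the contradiction will be [y = 1]. *)
have /trivgPn[y Oy /eqP[]] := nilpotent_pcoreC_neq1 _ _ _ nilN notppN p_pr.
have Gx : x \in G := subsetP (pcore_sub _ _) x Opx.
have Ny : y \in N := subsetP (pcore_sub _ _) y Oy.
have pOp := pcore_pgroup p G; have p'O := pcore_pgroup p^' N.
apply: equal_order_coprime_cent eqGN Gx N'x Ny _ _.
  (* Both are subgroups of coprime order in the nilpotent group ['F(G)]. *)
  have cOO : 'O_p^'(N) \subset 'C('O_p(G)).
    apply: sub_nilpotent_cent2 (Fitting_nil G) _ _ (pnat_coprime pOp p'O).
      exact: Fitting_max (pcore_normal _ _) (pgroup_nil pOp).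
    exact: subset_trans (pcore_sub _ _) sNF.
  exact/commute_sym/(centsP cOO).
exact: pnat_coprime (mem_p_elt pOp Opx) (mem_p_elt p'O Oy).
Qed.

(** Here [N :&: Q] is the Sylow [q]-subgroup [R] of the nilpotent group [N], so [N] is the direct
    product of [R] and the [q']-core [K]. Thus [N / R] is a copy of [K], and fixed points in the
    quotient can be lifted to [K]. *)
Lemma equal_order_Sylow_Frobenius (gT : finGroupType) (G N Q : {group gT})
    (q : nat) :
  equal_order_pair G N -> nilpotent N -> ~ prime_power_order N ->
  prime q -> q %| #|G / N| -> q.-Sylow(G) Q ->
  [Frobenius N * Q / (N :&: Q) = (N / (N :&: Q)) ><| (Q / (N :&: Q))].
Proof.
move=> eqGN nilN notppN q_pr q_dv sylQ; have [nsNG _ _ _] := eqGN.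
have [sQG qQ _] := and3P sylQ.
have nNQ := subset_trans sQG (normal_norm nsNG).
have sylR := Sylow_setI_normal nsNG sylQ.
have defR := nilpotent_Hall_pcore nilN sylR.
set R := (N :&: Q)%G in sylR defR; rewrite -[N :&: Q]/(gval R).
pose K := 'O_q^'(N)%G.
have /dprodP[_ defN _ tiRK] : R \x K = N by rewrite defR nilpotent_pcoreC.
have nRN : N \subset 'N(R) by rewrite defR gFnorm.
have nRQ : Q \subset 'N(R) by rewrite normsI ?normG.
have nKQ : Q \subset 'N(K) by rewrite gFnorm_trans.
have sKN : K \subset N := pcore_sub _ _.
have q'K : q^'.-group K := pcore_pgroup _ _.
have defNR : N / R = K / R by rewrite -defN quotientMidl.
have q'NR : q^'.-group (N / R) by rewrite defNR quotient_pgroup.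
have qQR : q.-group (Q / R) by rewrite quotient_pgroup.
rewrite quotientMl // -norm_joinEr ?quotient_norms //.
apply/Frobenius_semiregularP.
- rewrite sdprodEY ?quotient_norms //.
  by apply: coprime_TIg; rewrite coprime_sym; apply: pnat_coprime qQR q'NR.
- rewrite /= defNR -(isog_eq1 (quotient_isog (subset_trans sKN nRN) tiRK)).
  exact: nilpotent_pcoreC_neq1.
(* [Q / R] is isomorphic to [Q / N], a Sylow [q]-subgroup of [G / N], and [q] divides the order of
   [G / N]. *)
- rewrite (isog_eq1 (second_isog nNQ)).
  have := quotient_pHall nNQ sylQ => /card_Hall oQN.
  by rewrite trivg_card1 oQN p_part_eq1 mem_primes q_pr cardG_gt0 q_dv.
move=> xR /setD1P[ntxR /morphimP[x nRx Qx def_xR]].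
apply/trivgP/subsetP=> yR /setIP[]; rewrite /= defNR.
case/morphimP=> y nRy Ky -> /cent1P; rewrite def_xR => cxyR.
have Ny := subsetP sKN y Ky.
have N'x : x \notin N.
  apply: contra ntxR => Nx; rewrite def_xR; apply/eqP/coset_id.
  by rewrite inE Nx.
suffices -> : y = 1 by rewrite morph1 group1.
apply: (equal_order_coprime_cent _ _ _ x y eqGN) => //.
- exact: (subsetP sQG).
(* The commutator of [x] and [y] lies in [R], since their cosets commute, and in [K], which [x]
   normalises; these meet trivially. *)
- apply/commgP; rewrite -in_set1 -[[set 1]]tiRK inE.
  apply/andP; split.
    rewrite coset_idr ?groupR ?morphR //.
    exact/eqP/commgP.
  by rewrite commgEr groupM ?memJ_norm ?groupV // (subsetP nKQ).
exact: pnat_coprime (mem_p_elt qQ Qx) (mem_p_elt q'K Ky).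
Qed.

Theorem theoremB (gT : finGroupType) (G N : {group gT})
    (eqGN : equal_order_pair G N) (nilN : nilpotent N) :
  (forall p : nat, prime p -> p.-group N ->
     (forall H : {group gT}, H \subset G -> H :!=: 1 -> p^'.-group H ->
        [Frobenius N * H = N ><| H])
     /\ (forall q : nat, prime q -> q <> p ->
           forall Q : {group gT}, q.-Sylow(G) Q ->
           cyclic Q \/ generalized_quaternion Q))
  /\
  (~ prime_power_order N ->
     [/\ N :=: 'F(G),
         forall q : nat, prime q -> q %| #|G / N| ->
           forall Q : {group gT}, q.-Sylow(G) Q ->
           [Frobenius N * Q / (N :&: Q)
              = (N / (N :&: Q)) ><| (Q / (N :&: Q))]
       & forall q : nat, prime q ->
           forall P : {group coset_of N}, q.-Sylow(G / N) P ->
           cyclic P \/ generalized_quaternion P]).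
Proof.
have [nsNG _ _ _] := eqGN; split=> [p p_pr pN | notppN].
  have frobN H := equal_order_pgroup_Frobenius _ G N H p eqGN pN.
  split=> [|q q_pr neq_qp Q sylQ]; first exact: frobN.
  have [sQG qQ _] := and3P sylQ.
  have [-> | ntQ] := eqsVneq Q 1; first by left; exact: cyclic1.
  have p'Q : p^'.-group Q.
    by apply: pi_pnat qQ _; rewrite !inE; apply/eqP.
  have := frobN Q sQG ntQ p'Q.
  rewrite -norm_joinEr ?(subset_trans sQG (normal_norm nsNG)) // => frobNQ.
  exact: Frobenius_pgroup_compl frobNQ (nilpotent_sol nilN) qQ.
have frobN q Q := equal_order_Sylow_Frobenius _ G N Q q eqGN nilN notppN.
split=> [|q q_pr q_dv Q|q q_pr P sylP].
- exact: equal_order_Fitting.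
- exact: frobN.
have [Q sylQ] := Sylow_exists q G; have [sQG qQ _] := and3P sylQ.
have nNQ := subset_trans sQG (normal_norm nsNG).
(* [P] is conjugate to [Q / N], which is isomorphic to the Frobenius complement [Q / (N :&: Q)]. *)
have [x _ defP] := Sylow_trans (quotient_pHall nNQ sylQ) sylP.
have isoP : Q / (N :&: Q) \isog P.
  by apply: isog_trans (second_isog nNQ) _; rewrite defP conj_isog.
(* If [q] does not divide the order of [G / N], there is no Frobenius group to use, but [P] is
   trivial. *)
have [q_dv | q'GN] := boolP (q %| #|G / N|); last first.
  left; suffices -> : P :=: 1 by exact: cyclic1.
  by apply/eqP; rewrite trivg_card1 (card_Hall sylP) p_part_eq1 mem_primes
    (negPf q'GN) !andbF.
apply: (isog_cyclic_or_quaternion _ _ _ _ isoP).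
have := frobN q Q q_pr q_dv sylQ.
rewrite -norm_joinEr // => frobQ.
apply: Frobenius_pgroup_compl frobQ _ _; last exact: quotient_pgroup qQ.
exact: quotient_sol (nilpotent_sol nilN).
Qed.
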